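(* Let $w$ be a Sturmian word and let $u$ be a factor of $w$. Then $u$ has (exactly) two abelian returns in $w$ if and only if $u$ is singular.
   Context: A right infinite word $w=w_1w_2\cdots$ is Sturmian if for every $n\ge 0$ it has exactly $n+1$ distinct factors of length $n$ (so it is a recurrent word over a two-letter alphabet). A factor of $w$ is a finite block of consecutive letters occurring in $w$. $|u|$ is the length of a finite word $u$, and $|u|_a$ is the number of occurrences of the letter $a$ in $u$. Finite words $u,v$ are abelian equivalent, written $u\approx^{ab}v$, if $|u|_a=|v|_a$ for all letters $a$. For a recurrent infinite word $w$ and a factor $u$ of $w$, let $n_1<n_2<\cdots$ be all the integers $n_i$ such that $w_{n_i}\cdots w_{n_i+|u|-1}\approx^{ab}u$. Each word $w_{n_i}\cdots w_{n_{i+1}-1}$ is called an abelian return of $u$ in $w$. The factor $u$ has $k$ abelian returns if the set of its abelian returns consists of exactly $k$ classes for abelian equivalence. A factor $u$ of a Sturmian word $w$ is singular if it is the only factor of $w$ in its abelian class, i.e. every factor $v$ of $w$ with $v\approx^{ab}u$ equals $u$. *)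

(* Defs.v *)
From mathcomp Require Import all_boot.
From mathcomp Require Import boolp classical_sets cardinality.

Set Implicit Arguments.
Unset Strict Implicit.
Unset Printing Implicit Defensive.

Local Open Scope classical_set_scope.
Local Open Scope card_scope.

(* A right infinite word over the alphabet T is a function w : nat -> T; its
   letters are indexed from 0, so w 0 is the first letter. *)
Definition block (T : Type) (w : nat -> T) (i n : nat) : seq T :=
  mkseq (fun j => w (i + j)) n.

Definition factor (T : Type) (w : nat -> T) (u : seq T) : Prop :=
  exists i, block w i (size u) = u.

(* The alphabet is not assumed to have two letters: the case n = 1 says that
   exactly two letters of T occur in w. *)
Definition sturmian (T : Type) (w : nat -> T) : Prop :=
  forall n, [set u | factor w u /\ size u = n] #= `I_n.+1.

Definition abelian_equiv (T : eqType) (u v : seq T) : Prop :=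
  forall a, count_mem a u = count_mem a v.

Lemma abelian_equivP (T : eqType) (u v : seq T) :
  reflect (abelian_equiv u v) (perm_eq u v).
Proof.
apply: (iffP idP) => [/permP uv a|uv]; first exact: uv.
by apply/allP => a _ /=; rewrite uv.
Qed.

Definition abelian_occurrence (T : eqType) (w : nat -> T) (u : seq T)
    (i : nat) : Prop :=
  abelian_equiv (block w i (size u)) u.

(* i and j are consecutive terms of the increasing sequence of all the abelian
   occurrences of u. *)
Definition abelian_return (T : eqType) (w : nat -> T) (u r : seq T) : Prop :=
  exists i j, [/\ i < j, abelian_occurrence w u i, abelian_occurrence w u j,
    forall k, i < k < j -> ~ abelian_occurrence w u k
    & r = block w i (j - i)].

Definition abelian_class (T : eqType) (u : seq T) : set (seq T) :=
  [set v | abelian_equiv v u].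

(* Returns are counted up to abelian equivalence. *)
Definition has_abelian_returns (T : eqType) (w : nat -> T) (u : seq T)
    (k : nat) : Prop :=
  [set abelian_class r | r in [set r | abelian_return w u r]] #= `I_k.

Definition singular (T : eqType) (w : nat -> T) (u : seq T) : Prop :=
  factor w u /\ forall v, factor w v -> abelian_equiv v u -> v = u.

(* Main.v *)
(** A window of length n = |u| contains one of two consecutive numbers of
occurrences of a fixed letter (a Sturmian word is balanced); naming the letters
1 and 0 suitably, the abelian occurrences of u are the windows with the larger
number of 1s. Sliding the window shows that an abelian return of u is a letter
or a word 1v0 whose translate by n is 0v1, so that v is the unique right special
factor of its length. Hence the abelian class of a return determines the return
and, together with the current n-window, the next occurrence's n-window.

- There are always two occurrences with the same window and inequivalent
  returns, since otherwise w would be eventually periodic.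
- If u is singular, inequivalent returns branch at a right special factor that
  begins with u and contains u nowhere else. Right special factors being
  suffixes of one another, there is only one of these, so two returns at most.
- If u is not singular, let k < n be the least position at which two abelian
  occurrences of u carry different letters. Returns starting at occurrences that
  differ at position k are inequivalent. So the two inequivalent returns given
  by the first item, together with the return from an occurrence with the other
  letter at position k, make three classes. *)

Require Import Defs.
From mathcomp Require Import all_boot.
From mathcomp Require Import boolp classical_sets functions cardinality.
From mathcomp Require Import zify.

Set Implicit Arguments.
Unset Strict Implicit.
Unset Printing Implicit Defensive.

(** * Words with n + 1 factors of length n *)

Lemma eq_block (T : Type) (w : nat -> T) i j n :
  block w i n = block w j n <-> forall k, k < n -> w (i + k) = w (j + k).
Proof.
split=> [E k kn|E]; last by apply/eq_in_map => k; rewrite mem_iota; apply: E.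
by have := congr1 (nth (w i) ^~ k) E; rewrite !nth_mkseq.
Qed.

Lemma blockD (T : Type) (w : nat -> T) i m n :
  block w i (m + n) = block w i m ++ block w (i + m) n.
Proof.
rewrite /block /mkseq iotaD map_cat add0n; congr (_ ++ _).
rewrite -[m in iota m n]addn0 iotaDl -map_comp.
by apply: eq_map => k /=; rewrite addnA.
Qed.

Lemma blockS (T : Type) (w : nat -> T) i n :
  block w i n.+1 = w i :: block w i.+1 n.
Proof.
by rewrite -add1n blockD addn1 /block /= addn0.
Qed.

Lemma blockSr (T : Type) (w : nat -> T) i n :
  block w i n.+1 = rcons (block w i n) (w (i + n)).
Proof. by rewrite -addn1 blockD blockS cats1. Qed.

Lemma size_block (T : Type) (w : nat -> T) i n : size (block w i n) = n.
Proof. exact: size_mkseq. Qed.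

Lemma uniq_map_inj (T1 T2 : eqType) (f : T1 -> T2) (s : seq T1) :
  uniq (map f s) -> {in s &, injective f}.
Proof.
elim: s => //= x s IH /andP[xs /IH {}IH] y z.
rewrite !inE => /predU1P[->|ys] /predU1P[->|zs] // E; last exact: IH.
- by rewrite E map_f in xs.
- by rewrite -E map_f in xs.
Qed.

Section Complexity.
Context (T : eqType) (w : nat -> T).
(** Having exactly n + 1 blocks of length n is encoded by lists of positions: no list with pairwise
    distinct blocks is longer than n + 1, and some list attains this length. *)
Hypothesis blocks_le :
  forall n s, uniq [seq block w i n | i <- s] -> size s <= n.+1.
Hypothesis blocks_ge :
  forall n, exists2 s, size s = n.+1 & uniq [seq block w i n | i <- s].

Lemma block_collision n (f : nat -> nat) :
  exists i j, [/\ i < j, j <= n.+1 & block w (f i) n = block w (f j) n].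
Proof.
have : ~~ uniq [seq block w i n | i <- mkseq f n.+2].
  by apply/negP => /blocks_le; rewrite size_mkseq ltnn.
case/(uniqPn [::]) => i [j []]; rewrite size_map size_mkseq => ij jn.
have jn' := ltn_trans ij jn.
rewrite /mkseq -map_comp !(nth_map 0) ?size_iota // !nth_iota //= => E.
by exists i, j.
Qed.

(** Every position has the same blocks as some position below N + p, which leaves too few blocks of
    length N + p. *)
Lemma aperiodic N p : 0 < p -> (forall i, N <= i -> w (i + p) = w i) -> False.
Proof.
move=> p_gt0 per.
have perm x q : w (N + (x + q * p)) = w (N + x).
  elim: q => [|q IH]; first by rewrite mul0n addn0.
  by rewrite -IH -[RHS]per ?leq_addr //; congr w; lia.
have {perm} modE x : w (N + x) = w (N + x %% p).
  by rewrite {1}(divn_eq x p) addnC -(perm _ (x %/ p)); congr w; lia.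
pose g i := if i < N then i else N + (i - N) %% p.
have gE i n : block w (g i) n = block w i n.
  apply/eq_block => k _; rewrite /g; case: ltnP => // Ni.
  have -> : i + k = N + (i - N + k) by lia.
  by rewrite -addnA modE [RHS]modE modnDml.
have [s size_s uniq_s] := blocks_ge (N + p).
have : uniq (map g s).
  apply: (@map_uniq _ _ (fun i => block w i (N + p))).
  by rewrite -map_comp (eq_map (fun i => gE i _)).
move/(@uniq_leq_size _ _ (iota 0 (N + p))); rewrite size_map size_iota size_s.
rewrite ltnn => H; suff: false by []; apply: H => x /mapP[i _ ->].
rewrite mem_iota /= /g; case: (ltnP i N) => [|_]; first by lia.
by have := ltn_pmod (i - N) p_gt0; lia.
Qed.

Lemma block_next i j n : block w i n = block w j n -> w (i + n) = w (j + n) ->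
  block w i.+1 n = block w j.+1 n.
Proof.
move=> E1 E2; have : block w i n.+1 = block w j n.+1 by rewrite !blockSr E1 E2.
by rewrite !blockS; case.
Qed.

(** Otherwise each block beyond N determines the next letter; two equal blocks, provided by the
    pigeonhole principle, would then make [w] eventually periodic. *)
Lemma special_late N n : exists i j,
  [/\ N <= i, N <= j, block w i n = block w j n & w (i + n) <> w (j + n)].
Proof.
apply: contrapT => nospec.
have det i j : N <= i -> N <= j -> block w i n = block w j n ->
    w (i + n) = w (j + n).
  by move=> Ni Nj E; apply: contrapT => ne; apply: nospec; exists i, j.
have [i [j [ij _ E]]] := block_collision n (addn N).
have E' m : block w (N + i + m) n = block w (N + j + m) n.
  elim: m => [|m IH]; first by rewrite !addn0.
  have /(block_next IH) : w (N + i + m + n) = w (N + j + m + n).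
    by apply: det IH; lia.
  by rewrite !addnS.
apply: (@aperiodic (N + i + n) (j - i)); first by lia.
move=> k kN; have kE : k = N + i + (k - (N + i + n)) + n by lia.
rewrite [in RHS]kE (det _ _ _ _ (E' _)); try lia.
by congr w; lia.
Qed.

(** Each right special block adds a block when the length passes from n to n + 1, so two of them
    would give n + 3 blocks of length n + 1. *)
Lemma special_uniq n i i' j j' :
  block w i n = block w i' n -> w (i + n) <> w (i' + n) ->
  block w j n = block w j' n -> w (j + n) <> w (j' + n) ->
  block w i n = block w j n.
Proof.
move=> iE ine jE jne; apply: contrapT => ij.
have [s size_s uniq_s] := blocks_ge n.
have rep x : exists2 k, k \in s & block w k n = block w x n.
  have : ~~ uniq [seq block w k n | k <- x :: s].
    by apply/negP => /blocks_le /=; rewrite size_s ltnn.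
  by rewrite /= uniq_s andbT negbK => /mapP[k ks ->]; exists k.
(* [s] holds one position per block of length n, so it misses at least one of the extensions of a
   special block. *)
have new x x' : block w x n = block w x' n -> w (x + n) <> w (x' + n) ->
    exists2 y, block w y n = block w x n
    & block w y n.+1 \notin [seq block w k n.+1 | k <- s].
  move=> xE xne; have [k0 k0s k0E] := rep x.
  have [y yE yne] : exists2 y, block w y n = block w x n & w (y + n) <> w (k0 + n).
    have [xk|/eqP xk] := eqVneq (w (x + n)) (w (k0 + n)); last by exists x.
    by exists x' => // x'k; apply: xne; rewrite xk.
  exists y => //; apply/mapP => -[k ks].
  move/eq_block => E; apply: yne; rewrite E //; suff -> : k = k0 by [].
  have : block w k n = block w k0 n.
    by rewrite k0E -yE; apply/eq_block => l ln; rewrite E //; lia.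
  exact: (uniq_map_inj uniq_s).
have [y yE yN] := new _ _ iE ine.
have [z zE zN] := new _ _ jE jne.
suff /blocks_le : uniq [seq block w k n.+1 | k <- [:: y, z & s]].
  by rewrite /= size_s; lia.
rewrite /= inE negb_or yN zN /= andbT; apply/andP; split.
  apply/eqP => /eq_block yz; apply: ij; rewrite -yE -zE.
  by apply/eq_block => l ln; apply: yz; lia.
apply/(@map_uniq _ _ (take n)); rewrite -map_comp (eq_map (g := block w ^~ n)) //.
by move=> k /=; rewrite blockSr -cats1 take_size_cat ?size_block.
Qed.
End Complexity.

(** * Balance *)

Definition weight (b : nat -> bool) i n := count_mem true (block b i n).

Lemma weightD b i m n : weight b i (m + n) = weight b i m + weight b (i + m) n.
Proof. by rewrite /weight blockD count_cat. Qed.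

Lemma weightS b i n : weight b i n.+1 = b i + weight b i.+1 n.
Proof. by rewrite /weight blockS /= eqb_id. Qed.

Lemma weightSr b i n : weight b i n.+1 = weight b i n + b (i + n).
Proof. by rewrite /weight blockSr -cats1 count_cat /= eqb_id addn0. Qed.

Lemma weight_shift b i n : weight b i n + b (i + n) = b i + weight b i.+1 n.
Proof. by rewrite -weightSr weightS. Qed.

Lemma eq_weight b i j n : block b i n = block b j n -> weight b i n = weight b j n.
Proof. by rewrite /weight => ->. Qed.

Definition balanced b n := forall i j, weight b i n <= (weight b j n).+1.

Section Binary.
Context (b : nat -> bool).
Hypothesis blocks_le :
  forall n s, uniq [seq block b i n | i <- s] -> size s <= n.+1.
Hypothesis blocks_ge :
  forall n, exists2 s, size s = n.+1 & uniq [seq block b i n | i <- s].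

Let special_uniq := special_uniq blocks_le blocks_ge.
Let special_late := special_late blocks_le blocks_ge.

(* Here a v a occurs at i and a' v a' at j, with a' = ~~ a and |v| = l, and p
   carries the right special factor of length l + 1. If that factor were a v,
   none of the l + 2 windows of length l + 1 starting in j, ..., j + l + 1 would
   be special; two of them would coincide and from then on b would repeat
   itself, never meeting a special factor again. *)
Lemma special_head a l i j p p' : (forall m, m <= l.+1 -> balanced b m) ->
    b i = a -> b (i + l.+1) = a -> b j = ~~ a -> b (j + l.+1) = ~~ a ->
    block b i.+1 l = block b j.+1 l ->
    block b p l.+1 = block b p' l.+1 -> b (p + l.+1) <> b (p' + l.+1) ->
  b p = ~~ a.
Proof.
move=> bal bi bil bj bjl ijE pE pne.
have [//|pa] := eqVneq (b p) (~~ a); exfalso.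
have {}pa : b p = a by case: (b p) (a) pa => [] [].
(* Both v and the block at p without its first letter are right special of length l. *)
have ipE : block b p.+1 l = block b i.+1 l.
  apply: (special_uniq (i' := p'.+1) (j' := j.+1)) ijE _.
  - by move: pE; rewrite !blockS; case.
  - by rewrite !addSnnS.
  - by rewrite !addSnnS bil bjl; case: (a).
have nonspec e : e <= l.+1 -> block b (j + e) l.+1 <> block b p l.+1.
  move=> el /eq_block E.
  have := E 0 isT; rewrite !addn0 pa => bje.
  have e_gt0 : 0 < e.
    by case: (posnP e) bje => // ->; rewrite addn0 bj; case: (a).
  have {}el : e <= l.
    rewrite -ltnS ltn_neqAle el andbT; apply/eqP => eE.
    by move: bje; rewrite eE bjl; case: (a).
  (* v = s a t, with |s| = e - 1, begins with t a', so a t a and a' t a' are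
     factors: this contradicts balance at length |t| + 2 <= l + 1. *)
  have [le il jl] : [/\ (l - e).+2 <= l.+1, i + e + (l - e).+1 = i + l.+1
      & j + e + (l - e).+1 = j + l.+1] by clear -el e_gt0; split; lia.
  move/eq_block: ijE => ijE; move/eq_block: ipE => ipE.
  have inner x : x < l - e -> b (i + e + 1 + x) = b (j + 1 + x).
    move=> xl.
    have [xl1 xl2] : x < l /\ e + x < l by clear -xl; lia.
    have -> : i + e + 1 + x = i.+1 + (e + x) by clear; lia.
    rewrite ijE //; have -> : j.+1 + (e + x) = j + e + x.+1 by clear; lia.
    by rewrite E // -addSnnS ipE // ijE // addn1.
  have bie : b (i + e) = a.
    by have := ijE e.-1; rewrite !addSnnS prednK // => ->.
  have bjle : b (j + (l - e).+1) = ~~ a.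
    have lel : l - e < l by clear -el e_gt0; lia.
    rewrite -addSnnS -ijE // -ipE // addSnnS -E //.
    by rewrite jl.
  have /eq_weight wE : block b (i + e).+1 (l - e) = block b j.+1 (l - e).
    apply/eq_block => x /inner; rewrite !addn1 !addSn => -> //.
  have wi : weight b (i + e) (l - e).+2 = a + weight b j.+1 (l - e) + a.
    by rewrite weightS weightSr bie wE addnA addSnnS il bil.
  have wj : weight b j (l - e).+2 = ~~ a + weight b j.+1 (l - e) + ~~ a.
    by rewrite weightS weightSr bj addSnnS bjle addnA.
  have := bal _ le (i + e) j; have := bal _ le j (i + e).
  by rewrite wi wj; clear; case: a => /=; lia.
(* Listing p as well accounts for the special block, which [nonspec] keeps out of the collision. *)
have [x [y [xy yl E]]] := block_collision blocks_le l.+1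
  (fun k => if k is k'.+1 then j + k' else p).
case: x y => [|x] [|y] // in xy yl E *.
  by case: (nonspec y) => //; rewrite E.
have cyc g : exists2 h, x <= h < y & block b (j + x + g) l.+1 = block b (j + h) l.+1.
  elim: g => [|g [h hxy IH]]; first by exists x; rewrite ?addn0 //; clear -xy; lia.
  have next : block b (j + x + g.+1) l.+1 = block b (j + h.+1) l.+1.
    have /(block_next IH) : b (j + x + g + l.+1) = b (j + h + l.+1).
      apply: contrapT => ne; apply: (nonspec h); first by clear -hxy yl; lia.
      by rewrite -IH; apply: special_uniq IH ne pE pne.
    by rewrite !addnS.
  have [hy|hy] := eqVneq h.+1 y; last by exists h.+1 => //; clear -hxy hy; lia.
  by exists x; [clear -hxy; lia | rewrite next hy -E].
have [q [q' [qN _ qE qne]]] := special_late (j + x) l.+1.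
have [h hxy] := cyc (q - (j + x)); rewrite subnKC // => hE.
apply: (nonspec h); first by clear -hxy yl; lia.
by rewrite -hE; apply: special_uniq qE qne pE pne.
Qed.

(** At the least length where balance fails, the two windows begin with 1 v 1 and 0 v 0. Then
    [special_head], applied with both values of [a], makes the right special factor of length |v| +
    1 begin with both letters. *)
Lemma sturmian_balanced n : balanced b n.
Proof.
have [m] := ubnP n; elim: m n => // m IH [|n] nm i j; first by [].
rewrite leqNgt; apply/negP => unb.
have bal k : k <= n -> balanced b k by move=> kn; apply: IH; lia.
have [bi bj] : b i = true /\ b j = false.
  have := bal n (leqnn n) i.+1 j.+1; move: unb; rewrite !weightS.
  by case: (b i) (b j) => [] []; rewrite //=; lia.
have diff : exists x, (x < n) && (b (i.+1 + x) != b (j.+1 + x)).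
  apply: contrapT => nodiff; move: unb; rewrite !weightS bi bj.
  suff -> : weight b i.+1 n = weight b j.+1 n by lia.
  apply/eq_weight/eq_block => x xn; apply/eqP/negPn/negP => ne.
  by apply: nodiff; exists x; rewrite xn.
case: (ex_minnP diff) => x /andP[xn xne] xmin.
have xE : block b i.+1 x = block b j.+1 x.
  apply/eq_block => y yx; apply/eqP/negPn/negP => ne.
  by have := xmin y; rewrite (ltn_trans yx xn) ne leqNgt yx => /(_ isT).
(* In the opposite case the suffixes after this first difference would already be unbalanced. *)
have [bix bjx] : b (i.+1 + x) = true /\ b (j.+1 + x) = false.
  have := bal (n - x.+1) (leq_subr _ _) (i.+1 + x.+1) (j.+1 + x.+1).
  move: unb; rewrite !weightS bi bj -(subnKC xn) !weightD !weightSr (eq_weight xE).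
  rewrite (subnKC xn).
  by case: (b (i.+1 + x)) (b (j.+1 + x)) xne => [] []; rewrite //=; lia.
have [p [p' [_ _ pE pne]]] := special_late 0 x.+1.
move: bix bjx; rewrite !addSnnS => bix bjx.
have le k : k <= x.+1 -> balanced b k by move=> kx; apply: bal; lia.
have pF := special_head (a := true) le bi bix bj bjx xE pE pne.
have pT := special_head (a := false) le bj bjx bi bix (esym xE) pE pne.
by rewrite pF in pT.
Qed.
End Binary.

(** * Returns to the heavy windows *)

Section Returns.
Context (b : nat -> bool).
Hypothesis blocks_le :
  forall n s, uniq [seq block b i n | i <- s] -> size s <= n.+1.
Hypothesis blocks_ge :
  forall n, exists2 s, size s = n.+1 & uniq [seq block b i n | i <- s].

Let special_uniq := special_uniq blocks_le blocks_ge.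
Context (n c i0 : nat).
(* The windows of weight c are the heavy ones, all others have weight c - 1. *)
Hypothesis heavy : forall i, weight b i n <= c <= (weight b i n).+1.
Hypothesis occ_i0 : weight b i0 n = c.

Local Notation occ i := (weight b i n == c).

(** If only light windows came from N on, sliding them would show the period n. *)
Lemma occ_late N : exists2 i, N <= i & occ i.
Proof.
apply: contrapT => noocc.
have light i : N <= i -> weight b i n = c.-1.
  move=> Ni; have : ~~ occ i by apply/negP => oi; apply: noocc; exists i.
  by have := heavy i; lia.
have [n0|n_gt0] := posnP n.
  by apply: noocc; exists N => //; rewrite -occ_i0 n0.
apply: (aperiodic blocks_ge n_gt0 (N := N)) => i Ni.
have := weight_shift b i n; rewrite !light ?(leqW Ni) //.
by case: (b i) (b (i + n)) => [] []; rewrite //=; lia.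
Qed.

Definition ret i j := [/\ i < j, occ i, occ j & forall k, i < k < j -> ~~ occ k].

Lemma ret_exists i : occ i -> exists j, ret i j.
Proof.
move=> oi; have [j0 ij0 oj0] := occ_late i.+1.
have ex : exists j, (i < j) && occ j by exists j0; rewrite ij0.
case: (ex_minnP ex) => j /andP[ij oj] jmin; exists j; split=> // k /andP[ik kj].
by apply: contraTN kj => ok; rewrite -leqNgt jmin ?ik.
Qed.

(** For binary words, the length and the number of 1s determine the abelian class. *)
Definition equiv_ret i j i' j' :=
  j - i = j' - i' /\ weight b i (j - i) = weight b i' (j' - i').

(* The return is a letter or 1 v 0 (|v| = m), and its translate by n is the
   same letter or 0 v 1. *)
Lemma ret_shape i j : ret i j -> 
  (j = i.+1 /\ b (i + n) = b i) \/
  exists m, [/\ j = i + m.+2, b i /\ b (i + n) = false,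
    b (i.+1 + m) = false /\ b (i.+1 + m + n)
    & block b (i.+1 + n) m = block b i.+1 m].
Proof.
move=> [ij oi oj between].
have light k : i < k < j -> weight b k n = c.-1 /\ 0 < c.
  by move=> /between; have := heavy k; lia.
have [jE|ij1] := eqVneq j i.+1; [left|right].
  split=> //; have := weight_shift b i n; rewrite -jE (eqP oi) (eqP oj).
  by case: (b i) (b (i + n)) => [] []; rewrite //=; lia.
have {ij1} ij : i.+1 < j by rewrite ltn_neqAle eq_sym ij1.
exists (j - i.+2); have -> : i.+1 + (j - i.+2) = j.-1 by lia.
split; first by lia.
- have := weight_shift b i n; rewrite (eqP oi).
  have [|-> c_gt0] := light i.+1; first by rewrite leqnn.
  by case: (b i) (b (i + n)) => [] []; rewrite //=; lia.
- have := weight_shift b j.-1 n; rewrite prednK; last by lia.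
  rewrite (eqP oj); have [|-> c_gt0] := light j.-1; first by lia.
  by case: (b j.-1) (b (j.-1 + n)) => [] []; rewrite //=; lia.
apply/eq_block => k kj; have := weight_shift b (i.+1 + k) n.
by rewrite addnAC !(proj1 (light _ _)); lia.
Qed.

(** A one-letter return is given by its weight. In 1 v 0 the word v is right special, followed by 0
    here and by 1 in the translate by n, so its length determines it. *)
Lemma ret_word i j i' j' : ret i j -> ret i' j' -> equiv_ret i j i' j' ->
  block b i (j - i) = block b i' (j - i) /\
  block b (i + n) (j - i) = block b (i' + n) (j - i).
Proof.
move=> r r' []; case: (ret_shape r) => [[-> bE]|[m [-> [bi bin] [bim bimn] inner]]];
case: (ret_shape r') => [[-> bE']|[m' [-> [bi' bin'] [bim' bimn'] inner']]].
- rewrite !subSnn /weight !blockS bE bE' => _ /=.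
  by case: (b i) (b i') => [] [].
- by move=> H; exfalso; move: H; clear; lia.
- by move=> H; exfalso; move: H; clear; lia.
rewrite !addKn => -[mm]; subst m' => _.
have E : block b i.+1 m = block b i'.+1 m.
  apply: (special_uniq (i' := i.+1 + n) (j' := i'.+1 + n)) => //.
  - by rewrite addnAC bim bimn.
  - by rewrite addnAC bim' bimn'.
rewrite !(blockS _ _ m.+1) !blockSr; rewrite -!addSn inner inner' E.
rewrite [_ + n + m]addnAC [i'.+1 + n + m]addnAC.
by rewrite bi bi' bin bin' bim bim' bimn bimn'.
Qed.

(** Induction along the occurrences: equal windows have equivalent returns, hence equal ones, and
    these lead to equal windows again. *)
Lemma occ_det : (forall i j i' j', ret i j -> ret i' j' ->
    block b i n = block b i' n -> equiv_ret i j i' j') ->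
  forall x i i', occ i -> occ i' -> block b i n = block b i' n ->
  b (i + x) = b (i' + x).
Proof.
move=> det x; have [m] := ubnP x; elim: m x => // m IH x xm i i' oi oi' ii'.
have [j r] := ret_exists oi; have [j' r'] := ret_exists oi'.
have e := det _ _ _ _ r r' ii'; have [jE _] := e.
have [/eq_block w1 /eq_block w2] := ret_word r r' e.
have [xj|jx] := ltnP x (j - i); first exact: w1.
have [ij _ oj _] := r; have [ij' _ oj' _] := r'.
have -> : i + x = j + (x - (j - i)) by clear -ij jx; lia.
have -> : i' + x = j' + (x - (j - i)) by clear -ij' jE jx; lia.
apply: IH => //; first by clear -jx xm ij; lia.
(* The next window consists of a possibly empty tail of the current one and of letters from the
   translate of the return. *)
apply/eq_block => k kn.
have -> : j + k = i + (j - i + k) by clear -ij; lia.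
have -> : j' + k = i' + (j - i + k) by clear -ij' jE; lia.
have [lt|ge] := ltnP (j - i + k) n; first by move/eq_block: ii' => ->.
rewrite -[j - i + k](subnKC ge) !addnA w2 //.
by clear -kn ge ij; lia.
Qed.

(** Otherwise, by [occ_det], a heavy window determines all that follows it; among n + 2 occurrences
    two share their window, so [b] is eventually periodic. *)
Lemma two_returns : exists i j i' j',
  [/\ ret i j, ret i' j', block b i n = block b i' n & ~ equiv_ret i j i' j'].
Proof.
apply: contrapT => nex.
have det i j i' j' : ret i j -> ret i' j' -> block b i n = block b i' n ->
    equiv_ret i j i' j'.
  by move=> r r' ii'; apply: contrapT => ne; apply: nex; exists i, j, i', j'.
have ex N : exists i, (N <= i) && occ i.
  by have [i Ni oi] := occ_late N; exists i; rewrite Ni.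
pose f k := iter k (fun N => ex_minn (ex N.+1)) i0.
have fS k : f k < f k.+1.
  by rewrite /f iterS; case: ex_minnP => i /andP[].
have of_ k : occ (f k).
  case: k => [|k]; first by rewrite /f /= occ_i0.
  by rewrite /f iterS; case: ex_minnP => i /andP[].
have [k [l [kl _ E]]] := block_collision blocks_le n f.
have {}kl : f k < f l by rewrite (homo_ltn ltn_trans fS).
apply: (aperiodic blocks_ge (N := f k) (p := f l - f k)); first by rewrite subn_gt0.
move=> i ki; rewrite -[in RHS](subnKC ki) (occ_det det _ (of_ k) (of_ l) E).
by congr b; clear -ki kl; lia.
Qed.

(** The windows that decide where the return ends all lie within these letters. *)
Lemma ret_agree i j i' j' : ret i j -> ret i' j' ->
  block b i ((j - i) + n) = block b i' ((j - i) + n) -> equiv_ret i j i' j'.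
Proof.
move=> [ij _ oj btw] [ij' _ oj' btw'] E.
have occE k : k <= j - i -> occ (i + k) = occ (i' + k).
  move=> kj; suff /eq_weight -> : block b (i + k) n = block b (i' + k) n by [].
  apply/eq_block => x xn; rewrite -!addnA.
  by move/eq_block: E; apply; rewrite -addnS leq_add.
suff jE : j - i = j' - i'.
  by split=> //; rewrite -jE; move: E; rewrite !blockD => /eqP;
    rewrite eqseq_cat ?size_block // => /andP[/eqP /eq_weight].
have [lt|lt|//] := ltngtP (j - i) (j' - i').
- have /negP[] := btw' (i' + (j - i)) ltac:(clear -ij ij' lt; lia).
  by rewrite -occE // subnKC // ltnW.
- have /negP[] := btw (i + (j' - i')) ltac:(clear -ij ij' lt; lia).
  by rewrite occE ?(ltnW lt) // subnKC // ltnW.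
Qed.

(** [m] is the first place where the continuations differ: not inside the common window, and not
    past the letters that determine either return. *)
Lemma ret_diverge i j i' j' : ret i j -> ret i' j' ->
    block b i n = block b i' n -> ~ equiv_ret i j i' j' ->
  exists m, [/\ n <= m, m < j - i + n, m < j' - i' + n,
    block b i m = block b i' m & b (i + m) <> b (i' + m)].
Proof.
move=> r r' /eq_block ii' ne.
have ne' : ~ equiv_ret i' j' i j by move=> [e1 e2]; apply: ne; split.
have diff : exists m, b (i + m) != b (i' + m).
  apply: contrapT => nodiff; apply: ne; apply: ret_agree r r' _.
  apply/eq_block => x _; apply/eqP/negPn/negP => xne.
  by apply: nodiff; exists x.
case: (ex_minnP diff) => m mne mmin; exists m.
have agree x : x < m -> b (i + x) = b (i' + x).
  by move=> xm; apply/eqP; apply: contraTT xm => /mmin; rewrite -leqNgt.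
split; last exact/eqP.
- by rewrite leqNgt; apply: contra_notN (elimN eqP mne) => /ii'.
- rewrite ltnNge; apply: contra_notN ne => mj; apply: ret_agree r r' _.
  by apply/eq_block => x xj; apply: agree; apply: leq_trans mj.
- rewrite ltnNge; apply: contra_notN ne' => mj; apply: ret_agree r' r _.
  by apply/eq_block => x xj; rewrite agree //; apply: leq_trans mj.
- exact/eq_block.
Qed.

(** If m < m', uniqueness makes the special block at s a suffix of the one at i. It begins with a
    heavy window, which puts an occurrence at i + (m' - m), strictly inside the return. *)
Lemma special_first i j s q r m m' : ret i j -> occ s -> n <= m ->
  m' < j - i + n ->
  block b s m = block b q m -> b (s + m) <> b (q + m) ->
  block b i m' = block b r m' -> b (i + m') <> b (r + m') -> m' <= m.
Proof.
move=> [ij _ _ btw] os nm m'j sE sne iE ine; rewrite leqNgt; apply/negP => mm'.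
have dE p : p + m' = p + (m' - m) + m by clear -mm'; lia.
have E : block b (i + (m' - m)) m = block b s m.
  apply: (special_uniq (i' := r + (m' - m)) (j' := q)) => //; last by rewrite -!dE.
  apply/eq_block => x xm; rewrite -!addnA; move/eq_block: iE; apply.
  by clear -xm mm'; lia.
have /negP[] := btw (i + (m' - m)) ltac:(clear -ij nm m'j mm'; lia).
suff /eq_weight -> : block b (i + (m' - m)) n = block b s n by [].
by apply/eq_block => x xn; move/eq_block: E; apply; apply: leq_trans nm.
Qed.

(** By [special_first], three pairwise inequivalent returns would all diverge at the same position,
    which would need three different letters there. *)
Lemma singular_returns : (forall i j, occ i -> occ j -> block b i n = block b j n) ->
  forall i j i' j' i'' j'', ret i j -> ret i' j' -> ret i'' j'' ->
  [\/ equiv_ret i j i' j', equiv_ret i j i'' j'' | equiv_ret i' j' i'' j''].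
Proof.
move=> sing i j i' j' i'' j'' r r' r''.
have [//|ne1] := pselect (equiv_ret i j i' j'); first by constructor 1.
have [//|ne2] := pselect (equiv_ret i j i'' j''); first by constructor 2.
have [//|ne3] := pselect (equiv_ret i' j' i'' j''); first by constructor 3.
have [_ oi _ _] := r; have [_ oi' _ _] := r'; have [_ oi'' _ _] := r''.
have [m1 [n1 lt1 lt1' E1 d1]] := ret_diverge r r' (sing _ _ oi oi') ne1.
have [m2 [n2 lt2 lt2' E2 d2]] := ret_diverge r r'' (sing _ _ oi oi'') ne2.
have [m3 [n3 lt3 lt3' E3 d3]] := ret_diverge r' r'' (sing _ _ oi' oi'') ne3.
have m12 : m1 = m2.
  apply/eqP; rewrite eqn_leq; apply/andP; split.
    exact: (special_first r oi n2 lt1 E2 d2 E1 d1).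
  exact: (special_first r oi n1 lt2 E1 d1 E2 d2).
have d1' : b (i' + m1) <> b (i + m1) by apply: nesym.
have m13 : m1 = m3.
  apply/eqP; rewrite eqn_leq; apply/andP; split.
    exact: (special_first r' oi' n3 lt1' E3 d3 (esym E1) d1').
  exact: (special_first r' oi' n1 lt3 (esym E1) d1' E3 d3).
move: d1 d2 d3; rewrite -m12 -m13.
by case: (b (i + m1)) (b (i' + m1)) (b (i'' + m1)) => [] [] [].
Qed.

Lemma two_returns_singular : (forall i j i' j' i'' j'',
    ret i j -> ret i' j' -> ret i'' j'' ->
    [\/ equiv_ret i j i' j', equiv_ret i j i'' j'' | equiv_ret i' j' i'' j'']) ->
  forall i j, occ i -> occ j -> block b i n = block b j n.
Proof.
move=> two i0' j0 oi0 oj0; apply: contrapT => ne.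
pose differ k := `[< exists p q, [/\ occ p, occ q & b (p + k) <> b (q + k)] >].
have ex : exists k, (k < n) && differ k.
  apply: contrapT => nex; apply: ne; apply/eq_block => k kn.
  apply: contrapT => kne; apply: nex; exists k; rewrite kn /=.
  by apply/asboolP; exists i0', j0.
case: (ex_minnP ex) => k /andP[kn /asboolP[p [q [op oq pq]]]] kmin.
have same x s t : x < k -> occ s -> occ t -> b (s + x) = b (t + x).
  move=> xk os ot; apply: contrapT => xne; move: (xk); rewrite ltnNge kmin //.
  by rewrite (ltn_trans xk kn); apply/asboolP; exists s, t.
(* If the return has length at most k, the letter at k sits at a smaller position of the next
   occurrence, where all occurrences agree. *)
have sep s s' t t' : ret s s' -> ret t t' -> equiv_ret s s' t t' ->
    b (s + k) = b (t + k).
  move=> rs rt e; have [/eq_block E _] := ret_word rs rt e.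
  have [|le] := ltnP k (s' - s); first exact: E.
  case: e => e _; case: rs rt => ss _ os' _ [tt _ ot' _].
  have -> : s + k = s' + (k - (s' - s)) by clear -le ss; lia.
  have -> : t + k = t' + (k - (s' - s)) by clear -le tt e; lia.
  by apply: same => //; clear -le ss; lia.
have [i [j [i' [j' [r r' /eq_block ii' ne']]]]] := two_returns.
(* The return from s is equivalent to one of the returns from i and i', which carry the same letter
   at k because k < n. *)
have third s : occ s -> b (s + k) = b (i + k).
  move=> os; have [s' rs] := ret_exists os.
  have [//|/sep ->|/sep] := two _ _ _ _ _ _ r r' rs => //.
  by rewrite ii' // => ->.
by apply: pq; rewrite !third.
Qed.
End Returns.

(** * From Sturmian words to binary codings *)

Lemma card_eq_I2P (T : Type) (A : set T) :
  card_eq A `I_2 <->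
  (exists x y, [/\ A x, A y & x <> y]) /\
  (forall x y z, A x -> A y -> A z -> [\/ x = y, x = z | y = z]).
Proof.
split=> [/card_set_bijP[f [fI finj fsurj]]|[[x [y [Ax Ay xy]]] A2]].
  split.
    have [x Ax fx] := fsurj 0 isT; have [y Ay fy] := fsurj 1 isT.
    by exists x, y; split=> // xy; move: fx; rewrite xy fy.
  move=> x y z Ax Ay Az.
  have inj s t : A s -> A t -> f s = f t -> s = t.
    by move=> As At; apply: finj; rewrite in_setE.
  have [E|[E|E]] : f x = f y \/ f x = f z \/ f y = f z.
  - by move: (fI _ Ax) (fI _ Ay) (fI _ Az); rewrite /mkset /=; lia.
  - by constructor 1; apply: inj E.
  - by constructor 2; apply: inj E.
  - by constructor 3; apply: inj E.
apply/card_set_bijP; exists (fun z => nat_of_bool `[< z = y >]); split.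
- by move=> z _ /=; case: asboolP.
- move=> s t; rewrite !in_setE => As At.
  case: asboolP => [->|sy]; case: asboolP => [->|ty] // _.
  by case: (A2 s t y).
case=> [|[|//]] _; last by exists y => //=; case: asboolP.
by exists x => //=; case: asboolP.
Qed.

Lemma abelian_class_eq (T : eqType) (u v : seq T) :
  abelian_class u = abelian_class v <-> abelian_equiv u v.
Proof.
split=> [E|uv]; first by have : abelian_class u u by []; rewrite E.
by apply/seteqP; split=> r ru a; rewrite ru uv.
Qed.

Lemma block_factor (T : Type) (w : nat -> T) i n : factor w (block w i n).
Proof. by exists i; rewrite size_block. Qed.

(** * Counting the blocks of a Sturmian word *)

Section SturmianBlocks.
Context (T : eqType) (w : nat -> T).
Hypothesis w_sturmian : sturmian w.

Lemma sturmian_blocks_le n s : uniq [seq block w i n | i <- s] -> size s <= n.+1.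
Proof.
have /card_set_bijP[f [fI finj _]] := w_sturmian n => us.
rewrite -(size_iota 0 n.+1) -(size_map (f \o block w ^~ n) s).
apply: uniq_leq_size => [|_ /mapP[i _ ->]]; last first.
  by rewrite mem_iota; apply: fI; split; [exact: block_factor | exact: size_block].
rewrite map_comp map_inj_in_uniq // => _ _ /mapP[i _ ->] /mapP[j _ ->].
by apply: finj; rewrite in_setE; split; [exact: block_factor | exact: size_block
  |exact: block_factor | exact: size_block].
Qed.

Lemma sturmian_blocks_ge n :
  exists2 s, size s = n.+1 & uniq [seq block w i n | i <- s].
Proof.
have /card_set_bijP[f [_ _ fsurj]] := w_sturmian n.
(* For k > n the position 0 is a dummy value. *)
have /choice[g gE] : forall k, exists i, k < n.+1 -> f (block w i n) = k.
  move=> k; have [kn|] := boolP (k < n.+1); last by exists 0.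
  by have [v [[i vE] sv] fk] := fsurj k kn; exists i => _; rewrite -fk -vE sv.
exists (map g (iota 0 n.+1)); first by rewrite size_map size_iota.
apply/(@map_uniq _ _ f); rewrite -!map_comp; set h := _ \o _.
have /eq_in_map -> : {in iota 0 n.+1, h =1 id} by move=> k; rewrite mem_iota => /gE.
by rewrite map_id iota_uniq.
Qed.

Lemma sturmian_letters : exists a a', a != a' /\ forall i, w i = a \/ w i = a'.
Proof.
have [[|i [|j []]] // _] := sturmian_blocks_ge 1.
rewrite /= !blockS inE !andbT => ij; exists (w i), (w j); split.
  by apply: contraNneq ij => ->; apply/eqP.
move=> k; have : ~~ uniq [seq block w i 1 | i <- [:: k; i; j]].
  by apply/negP => /sturmian_blocks_le.
rewrite /= !blockS !inE ij /= !andbT negbK.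
by case/orP => /eqP[->]; [left|right].
Qed.
End SturmianBlocks.

(** * Transfer of abelian notions to the binary coding *)

Section Coding.
Context (T : eqType) (w : nat -> T) (a a' : T).
Hypothesis w_sturmian : sturmian w.
Hypothesis aa' : a != a'.
Hypothesis letters : forall i, w i = a \/ w i = a'.

(** Either letter may be read as 1, so that u can always be made heavy. *)
Definition code (i : nat) : bool := w i == a.

Lemma code_block i n : block code i n = [seq x == a | x <- block w i n].
Proof. by rewrite /block /mkseq -map_comp. Qed.

Lemma code_blockP i j n :
  block code i n = block code j n <-> block w i n = block w j n.
Proof.
split=> [/eq_block E|E]; last by rewrite !code_block E.
apply/eq_block => k /E; rewrite /code.
case: (letters (i + k)) (letters (j + k)) => [] -> [] -> //.
  by rewrite eqxx eq_sym (negPf aa').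
by rewrite eqxx eq_sym (negPf aa').
Qed.

Lemma code_blocks_le n s : uniq [seq block code i n | i <- s] -> size s <= n.+1.
Proof.
move=> us; apply: (sturmian_blocks_le w_sturmian (n := n)).
apply: (@map_uniq _ _ (map (fun x => x == a))).
by rewrite -map_comp (eq_map (g := block code ^~ n)) // => i; rewrite code_block.
Qed.

Lemma code_blocks_ge n :
  exists2 s, size s = n.+1 & uniq [seq block code i n | i <- s].
Proof.
have [s size_s us] := sturmian_blocks_ge w_sturmian n; exists s => //.
rewrite map_inj_in_uniq; first exact: map_uniq us.
by move=> i j is_ js /code_blockP; apply: uniq_map_inj us _ _ is_ js.
Qed.

Lemma weight_code i n : weight code i n = count_mem a (block w i n).
Proof.
by rewrite /weight code_block count_map; apply: eq_count => x /=; rewrite eqb_id.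
Qed.

Lemma count_letters i n :
  count_mem a (block w i n) + count_mem a' (block w i n) = n.
Proof.
rewrite -[RHS](size_block w i n) -(count_predC (pred1 a)); congr (_ + _).
apply: eq_in_count => x /mapP[k _ ->] /=.
case: (letters (i + k)) => ->; first by rewrite eqxx (negPf aa').
by rewrite eqxx eq_sym aa'.
Qed.

Lemma abelian_equiv_block i m j n : abelian_equiv (block w i m) (block w j n) <->
  m = n /\ weight code i m = weight code j n.
Proof.
rewrite !weight_code; split=> [/[dup] E /abelian_equivP/perm_size|[<- E] x].
  by rewrite !size_block E.
have [->//|xa] := eqVneq x a.
have [->|xa'] := eqVneq x a'.
  by have := count_letters i m; have := count_letters j m; lia.
have count0 k : count_mem x (block w k m) = 0.
  apply/count_memPn/mapP => -[l _ xE].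
  by case: (letters (k + l)) => kl; rewrite xE kl eqxx in xa xa'.
by rewrite !count0.
Qed.

(** When u has the larger of the two numbers of [a], its occurrences, returns and singularity
    translate into the binary notions for [code], with c the weight of u. *)
Lemma returns_heavy i0 n :
  (forall i, weight code i n <= weight code i0 n <= (weight code i n).+1) ->
  has_abelian_returns w (block w i0 n) 2 <-> singular w (block w i0 n).
Proof.
set u := block w i0 n; set c := weight code i0 n => heavy.
have occP i : abelian_occurrence w u i <-> weight code i n == c.
  rewrite /abelian_occurrence size_block abelian_equiv_block.
  by split=> [[_ ->]|/eqP].
have retP r : abelian_return w u r <->
    exists i j, ret code n c i j /\ r = block w i (j - i).
  split=> -[i [j]].
    case=> ij /occP oi /occP oj btw ->; exists i, j; do 2 split=> //.
    by move=> k kij; apply/negP => /occP; apply: btw.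
  case=> -[ij oi oj btw] ->; exists i, j; split=> //; try exact/occP.
  by move=> k /btw/negP nk /occP.
have eqvP i j i' j' :
    abelian_class (block w i (j - i)) = abelian_class (block w i' (j' - i')) <->
    equiv_ret code i j i' j'.
  by rewrite abelian_class_eq abelian_equiv_block.
have singP : singular w u <-> (forall i j, weight code i n == c ->
    weight code j n == c -> block code i n = block code j n).
  split=> [[_ sing] i j /occP oi /occP oj|sing].
    apply/code_blockP; move: oi oj; rewrite /abelian_occurrence size_block.
    by move=> /(sing _ (block_factor _ _ _)) -> /(sing _ (block_factor _ _ _)) ->.
  split; first exact: block_factor.
  move=> v [i vE] vu; have := perm_size (introT (abelian_equivP _ _) vu).
  rewrite size_block => size_v; rewrite size_v in vE.
  rewrite -vE; apply/code_blockP/sing; rewrite ?eqxx //.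
  by apply/occP; rewrite /abelian_occurrence size_block vE.
rewrite /has_abelian_returns card_eq_I2P singP; split=> [[_ A2]|sing].
  apply: (two_returns_singular code_blocks_le code_blocks_ge heavy) => //.
  move=> i j i' j' i'' j'' r r' r''.
  have inA s t : ret code n c s t -> exists2 x, abelian_return w u x &
      abelian_class x = abelian_class (block w s (t - s)).
    by move=> rst; exists (block w s (t - s)) => //; apply/retP; exists s, t.
  by case: (A2 _ _ _ (inA _ _ r) (inA _ _ r') (inA _ _ r'')) => /eqvP;
    [constructor 1|constructor 2|constructor 3].
split.
  have [i [j [i' [j' [r r' _ ne]]]]] :=
    two_returns code_blocks_le code_blocks_ge heavy erefl.
  exists (abelian_class (block w i (j - i))), (abelian_class (block w i' (j' - i'))).
  split; last by move/eqvP.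
    by exists (block w i (j - i)) => //; apply/retP; exists i, j.
  by exists (block w i' (j' - i')) => //; apply/retP; exists i', j'.
move=> ? ? ? [_ /retP[i [j [r ->]]] <-] [_ /retP[i' [j' [r' ->]]] <-].
move=> [_ /retP[i'' [j'' [r'' ->]]] <-].
by case: (singular_returns code_blocks_le code_blocks_ge sing r r' r'') => /eqvP;
  [constructor 1|constructor 2|constructor 3].
Qed.
End Coding.

Theorem theorem4 (T : eqType) (w : nat -> T) (u : seq T)
    (w_sturmian : sturmian w) (u_factor : factor w u) :
  has_abelian_returns w u 2 <-> singular w u.
Proof.
case: u_factor => i0 <-; set n := size u.
have [a [a' [aa' letters]]] := sturmian_letters w_sturmian.
have letters' i : w i = a' \/ w i = a by case: (letters i); [right|left].
have a'a : a' != a by rewrite eq_sym.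
have bal := sturmian_balanced (code_blocks_le (a := a) w_sturmian)
  (code_blocks_ge w_sturmian aa' letters) n.
have [max|nmax] := pselect (forall i, weight (code w a) i n <= weight (code w a) i0 n).
  by apply: (returns_heavy w_sturmian aa' letters) => i; rewrite max bal.
have [k kn] : exists k, weight (code w a) i0 n < weight (code w a) k n.
  apply: contrapT => nk; apply: nmax => i; rewrite leqNgt; apply/negP => ni.
  by apply: nk; exists i.
(* The counts of [a] and [a'] in a window add up to n, so having the smaller number of [a] means
   having the larger number of [a']. *)
apply: (returns_heavy w_sturmian a'a letters') => i.
have := bal i i0; have := bal k i; have := bal k i0; move: kn.
rewrite !weight_code.
have := count_letters aa' letters i n; have := count_letters aa' letters i0 n.
by clear; lia.
Qed.
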